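(* Every interval graph belongs to $c$-$\textsc{And}(1)$.
   Context: All graphs are finite, simple and connected. A $c$-$\textsc{And}(1)$-realization of a graph $G=(V,E)$ is a family $\{([L(v),R(v)],p_v):v\in V\}$ of closed real intervals with $p_v=(L(v)+R(v))/2$ (the center of the interval) such that for distinct $u,v$: $uv\in E$ iff $p_v\in[L(u),R(u)]$ and $p_u\in[L(v),R(v)]$. $c$-$\textsc{And}(1)$ is the class of graphs admitting a $c$-$\textsc{And}(1)$-realization. An interval graph is the intersection graph of a family of real intervals. *)

(* Defs.v *)
From mathcomp Require Import all_boot all_order all_algebra.
From mathcomp Require Import reals.

Set Implicit Arguments.
Unset Strict Implicit.
Unset Printing Implicit Defensive.

Import Order.TTheory GRing.Theory Num.Theory.
Local Open Scope ring_scope.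

(* Finiteness is carried by [V : finType]. *)
Definition connected_simple_graph (V : finType) (E : rel V) : Prop :=
  [/\ symmetric E, irreflexive E & forall u v : V, connect E u v].

(* [interval R] covers open, closed, half-open and unbounded intervals. *)
Definition interval_graph (R : realType) (V : finType) (E : rel V) : Prop :=
  exists I : V -> interval R, forall u v : V, u != v ->
    (E u v <-> exists x : R, x \in I u /\ x \in I v).

Definition center (R : realType) (l r : R) : R := (l + r) / 2.

(* [lo <= hi]: the closed intervals are nonempty, possibly reduced to a point. *)
Definition cAnd1_realization (R : realType) (V : finType) (E : rel V)
    (lo hi : V -> R) : Prop :=
  (forall v : V, lo v <= hi v) /\
  (forall u v : V, u != v ->
    (E u v <-> center (lo v) (hi v) \in `[lo u, hi u] /\
               center (lo u) (hi u) \in `[lo v, hi v])).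

Definition cAnd1 (R : realType) (V : finType) (E : rel V) : Prop :=
  exists lo hi : V -> R, cAnd1_realization E lo hi.

(* Main.v *)
Require Import Defs.
From mathcomp Require Import all_boot all_order all_algebra.
From mathcomp Require Import reals.
From mathcomp Require Import lra.

(** Order the vertices by left endpoints: the neighbours of [u] that come after
    [u] then form a run immediately following [u], ending at position [m u]. Put
    the center of the vertex at position [i] at [3 ^ i], and let its interval end
    on the right just before [3 ^ (m + 1)]. On the right it captures exactly the
    centers up to position [m]; and its radius is at least [2 * 3 ^ i - 1], so
    on the left it captures all earlier centers. Hence adjacency of two
    vertices is decided by the interval of the earlier one. *)

Set Implicit Arguments.
Unset Strict Implicit.
Unset Printing Implicit Defensive.

Import Order.TTheory GRing.Theory Num.Theory.
Local Open Scope ring_scope.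

Lemma connected_has_neighbor (V : finType) (E : rel V) (u v : V) :
  connect E u v -> u != v -> exists w, E u w.
Proof.
case/connectP=> [[|w p] /= Ep ->]; first by rewrite eqxx.
by case/andP: Ep => Euw _ _; exists w.
Qed.

Lemma rank_of_key (d : Order.disp_t) (T : orderType d) (V : finType)
    (key : V -> T) :
  exists2 rank : V -> nat, injective rank &
    forall u v, (rank u < rank v)%N -> (key u <= key v)%O.
Proof.
pose le_key := relpre key <=%O.
pose s := sort le_key (enum V).
have in_s v : v \in s by rewrite mem_sort mem_enum.
exists (index^~ s) => [u v|u v]; first exact: index_inj.
apply: (sorted_ltn_index (leT := le_key)) => //.
  by move=> y x z; exact: le_trans.
by apply: sort_sorted => x y; exact: le_total.
Qed.

(** As [x] is past the left end of [K], it is past that of [J]. Either [x] is in [J], or [J] stops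
    before [x], and then [y], caught between the left end of [I] and [x], is in [I]. *)
Lemma interval_meet_between (R : realType) (I J K : interval R) (x y : R) :
  let left_end := fun L : interval R => let: Interval a _ := L in a in
  (left_end I <= left_end J)%O -> (left_end J <= left_end K)%O ->
  x \in I -> x \in K -> y \in J -> exists z, z \in I /\ z \in J.
Proof.
case: I J K => [a a'] [b b'] [c c'] /= ab bc.
rewrite !itv_boundlr => /andP[ax xa'] /andP[cx _] /andP[by_ yb'].
have [xb'|b'x] := leP (BRight x) b'.
  by exists x; rewrite !itv_boundlr ax xa' xb' (le_trans bc cx).
exists y; rewrite !itv_boundlr by_ yb' (le_trans ab by_) /=; split=> //.
exact: le_trans (le_trans yb' (ltW b'x)) xa'.
Qed.

Lemma cAnd1_of_rank (R : realType) (V : finType) (E : rel V)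
    (rank : V -> nat) :
  symmetric E -> injective rank ->
  (forall u v w, (rank u < rank v)%N -> (rank v < rank w)%N ->
     E u w -> E u v) ->
  cAnd1 R E.
Proof.
move=> symE rank_inj runE.
(* Admitting [u] itself makes the maximum attained, and at least [rank u], even when [u] has no
   later neighbour. *)
pose last u := (\max_(v | (v == u) || E u v) rank v)%N.
have rank_last u : (rank u <= last u)%N.
  by apply: leq_bigmax_cond; rewrite eqxx.
have lastE u v : (rank u < rank v)%N -> E u v = (rank v <= last u)%N.
  move=> uv; apply/idP/idP => [Euv|].
    by apply: leq_bigmax_cond; rewrite Euv orbT.
  have [|w] := @eq_bigmax_cond _ (fun w => (w == u) || E u w) rank.
    by apply/card_gt0P; exists u; rewrite unfold_in eqxx.
  rewrite unfold_in => nw last_w; rewrite [last u]last_w leq_eqVlt => /orP[/eqP/rank_inj vw|vw].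
    case/orP: nw; rewrite -vw // => /eqP vu.
    by move: uv; rewrite vu ltnn.
  case/orP: nw => [/eqP wu|]; last exact: runE.
  by move: (ltn_trans uv vw); rewrite wu ltnn.
pose p u : R := (3 ^ rank u)%:R.
(* Centers are integers, so subtracting 1 keeps the center at position [last u + 1] out of the
   closed interval. *)
pose hi u : R := (3 ^ (last u).+1)%:R - 1.
pose lo u : R := 2 * p u - hi u.
have centerE u : center (lo u) (hi u) = p u by rewrite /center /lo; lra.
have p_ge1 u : 1 <= p u by rewrite ler1n expn_gt0.
have p_mono u v : (rank u < rank v)%N -> p u <= p v.
  by move=> uv; rewrite ler_nat leq_exp2l // ltnW.
have hi_ge u : 3 * p u - 1 <= hi u.
  by rewrite lerD2r -natrM -expnS ler_nat leq_exp2l // ltnS.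
have p_le_hi u v : (p v <= hi u) = (rank v <= last u)%N.
  by rewrite lerBrDr natr1 ler_nat ltn_exp2l.
have edgeE u v : (rank u < rank v)%N ->
    E u v <-> p v \in `[lo u, hi u] /\ p u \in `[lo v, hi v].
  move=> uv; rewrite (lastE _ _ uv) -p_le_hi !in_itv /=.
  (* Every left end satisfies [lo <= 1 - p <= 0], below all centers; only [p v <= hi u] is in
     question. *)
  have := p_mono _ _ uv; have := (p_ge1 u, p_ge1 v, hi_ge u, hi_ge v).
  move=> [[[pu pv] hu] hv] puv; rewrite /lo; split=> [pvu|[/andP[]] //].
  by split; apply/andP; split; lra.
exists lo, hi; split=> [v|u v uv].
  by have := (p_ge1 v, hi_ge v); rewrite /lo => -[]; lra.
rewrite !centerE; case: (ltngtP (rank u) (rank v)) => [|vu|/rank_inj uv_eq].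
- exact: edgeE.
- by rewrite symE (edgeE _ _ vu); split=> -[].
- by rewrite uv_eq eqxx in uv.
Qed.

Theorem theorem3 (R : realType) (V : finType) (E : rel V)
    (hE : connected_simple_graph E) (hI : interval_graph R E) :
  cAnd1 R E.
Proof.
case: hE hI => symE irrE connE [I IE].
(* The key is a bound rather than a real: the order on bounds handles infinite ends and tells open
   ends from closed ones. *)
have [rank rank_inj rank_le] :=
  rank_of_key (fun v => let: Interval a _ := I v in a).
apply: (cAnd1_of_rank R symE rank_inj) => u v w uv vw Euw.
have neq_rank a b : (rank a < rank b)%N -> a != b.
  by move=> ab; apply/eqP => eq_ab; rewrite eq_ab ltnn in ab.
have neq_adj a b : E a b -> a != b.
  by move=> Eab; apply/eqP => eq_ab; rewrite eq_ab irrE in Eab.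
have [x [xu xw]] := (IE u w (neq_adj _ _ Euw)).1 Euw.
(* An empty [I v] would make [v] an isolated vertex. *)
have [t Evt] := connected_has_neighbor (connE v w) (neq_rank _ _ vw).
have [y [yv _]] := (IE v t (neq_adj _ _ Evt)).1 Evt.
apply: (IE u v (neq_rank _ _ uv)).2.
exact: interval_meet_between (rank_le _ _ uv) (rank_le _ _ vw) xu xw yv.
Qed.
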